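(* Let $\mathcal{L}$ be a regular language over a finite alphabet $\Sigma$ with minimal DFA $\mathcal{D}_{\mathcal{L}}$, and let $\mathcal{D}$ be a connected DFA recognizing $\mathcal{L}$. Then: (a) $\mathcal{D}$ can be constructed (up to isomorphism of DFAs) from $\mathcal{D}_{\mathcal{L}}$ by quota-based DFA expansion; (b) the Myhill-Nerode equivalence class sizes $q(v)$ of $\mathcal{D}$ (for $v$ a state of $\mathcal{D}_{\mathcal{L}}$) satisfy the enough arrows condition over the multigraph of $\mathcal{D}_{\mathcal{L}}$, with the start portfolio being one copy of the initial state: that is, for every state $w$ of $\mathcal{D}_{\mathcal{L}}$, $s(w)+\sum_v q(v)\,m_{vw}\ge q(w)$, where $s(w)=1$ if $w$ is the initial state and $s(w)=0$ otherwise, and $m_{vw}$ is the number of letters $\sigma\in\Sigma$ with $\delta(v,\sigma)=w$ in $\mathcal{D}_{\mathcal{L}}$.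
   Context: A DFA is a tuple $\mathcal{D}=(S,\Sigma,\delta,i,a)$ with finite state set $S$, finite alphabet $\Sigma$, transition map $\delta:S\times\Sigma\to S$ (extended in the usual way to $S\times\Sigma^*\to S$), initial state $i\in S$, and set of accept states $a\subset S$. It recognizes the language of all $w\in\Sigma^*$ with $\delta(i,w)\in a$. It is connected if every state is of the form $\delta(i,w)$ for some $w\in\Sigma^*$. Its directed multigraph has vertex set $S$ and, for each $(v,\sigma)\in S\times\Sigma$, one edge from $v$ to $\delta(v,\sigma)$ labeled $\sigma$. Every connected DFA $\mathcal{D}$ recognizing $\mathcal{L}$ has a quotient map $\phi$ from the states of $\mathcal{D}$ onto the states of $\mathcal{D}_{\mathcal{L}}$ that preserves initial state, accept and non-accept states, and transitions ($\delta(\phi(v),\sigma)=\phi(\delta(v,\sigma))$). The Myhill-Nerode equivalence classes of $\mathcal{D}$ are the sets $\phi^{-1}(v)$, and the class sizes are $q(v)=|\phi^{-1}(v)|$. A map of directed multigraphs sends vertices to vertices, edges to edges, and respects initial and terminal vertices; it is an immersion if for every vertex $v$ it is injective on the set of outgoing edges of $v$. A quota tree with root $*\in V(G)$ and quota $q$ over a directed multigraph $G$ is an immersion $f:T\to G$, where $T$ is a finite rooted tree with all edges directed away from its root, such that the root maps to $*$ and $|f^{-1}(v)|=q(v)$ for all $v\in V(G)$. Quota-based DFA expansion of $\mathcal{D}_{\mathcal{L}}=(S_0,\Sigma,\delta_0,i_0,a_0)$ with class sizes $q:S_0\to\mathbb{Z}_{>0}$ is the following construction. Choose a quota tree $f:T\to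 G$ with root $i_0$ and quota $q$ over the multigraph $G$ of $\mathcal{D}_{\mathcal{L}}$ (produced by a quota search in $G$, with some order of edge extraction). The new DFA has state set $V(T)$, initial state the root of $T$, and accept states $f^{-1}(a_0)$. For each edge of $T$ from $v$ to $w$ lying over an edge of $G$ labeled $\sigma$, set $\delta(v,\sigma)=w$. Each remaining transition $\delta(v,\sigma)$ is assigned an arbitrary element of $f^{-1}(\delta_0(f(v),\sigma))$. *)

(* Defs.v *)
From HB Require Import structures.
From mathcomp Require Import all_boot.

Set Implicit Arguments.
Unset Strict Implicit.
Unset Printing Implicit Defensive.

Record dfa (Sigma : finType) := Dfa {
  state :> finType;
  delta : state -> Sigma -> state;
  dfa_init : state;
  dfa_acc : {set state}
}.

Definition run (Sigma : finType) (D : dfa Sigma) (s : D) (w : seq Sigma) : D :=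
  foldl (@delta Sigma D) s w.

Definition recognizes (Sigma : finType) (D : dfa Sigma) (L : seq Sigma -> Prop) :
  Prop :=
  forall w, L w <-> run (dfa_init D) w \in dfa_acc D.

Definition connected_dfa (Sigma : finType) (D : dfa Sigma) : Prop :=
  forall s : D, exists w, s = run (dfa_init D) w.

Definition minimal_dfa (Sigma : finType) (D : dfa Sigma)
    (L : seq Sigma -> Prop) : Prop :=
  recognizes D L /\ forall D' : dfa Sigma, recognizes D' L -> #|D| <= #|D'|.

Definition quotient_map (Sigma : finType) (D D0 : dfa Sigma) (phi : D -> D0) :
  Prop :=
  [/\ forall v : D0, exists s : D, phi s = v,
      phi (dfa_init D) = dfa_init D0,
      forall s, (phi s \in dfa_acc D0) = (s \in dfa_acc D)
    & forall s sigma, delta (phi s) sigma = phi (delta s sigma)].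

Definition dfa_isomorphic (Sigma : finType) (D1 D2 : dfa Sigma) : Prop :=
  exists2 h : D1 -> D2, bijective h & quotient_map h.

Definition class_size (Sigma : finType) (D D0 : dfa Sigma) (phi : D -> D0)
    (v : D0) : nat :=
  #|[set s | phi s == v]|.

Record multigraph := Multigraph {
  vertex :> finType;
  edge : finType;
  source : edge -> vertex;
  target : edge -> vertex
}.

Definition dfa_graph (Sigma : finType) (D : dfa Sigma) : multigraph :=
  @Multigraph D (D * Sigma)%type (fun e => e.1) (fun e => delta e.1 e.2).

Definition multiplicity (G : multigraph) (v w : G) : nat :=
  #|[set e : edge G | (source e == v) && (target e == w)]|.

Lemma multiplicity_dfa_graph (Sigma : finType) (D : dfa Sigma) (v w : D) :
  @multiplicity (dfa_graph D) v w = #|[set sigma | delta v sigma == w]|.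
Proof.
have pair_inj : injective (fun sigma : Sigma => (v, sigma)) by move=> ? ? [].
rewrite /multiplicity -(card_imset _ pair_inj); apply: eq_card => -[u sigma].
rewrite inE /=; apply/andP/imsetP => [[/eqP -> h]|[tau]].
  by exists sigma; rewrite ?inE.
by rewrite inE => h [-> ->].
Qed.

(* [s] is the start portfolio, a multiset of vertices given by multiplicities. *)
Definition enough_arrows (G : multigraph) (s q : G -> nat) : Prop :=
  forall w : G, q w <= s w + \sum_(v : G) q v * multiplicity v w.

Record graph_map (T G : multigraph) := GraphMap {
  vmap :> T -> G;
  emap : edge T -> edge G;
  source_emap : forall e, source (emap e) = vmap (source e);
  target_emap : forall e, target (emap e) = vmap (target e)
}.

Definition immersion (T G : multigraph) (f : graph_map T G) : Prop :=
  forall e1 e2 : edge T,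
    source e1 = source e2 -> emap f e1 = emap f e2 -> e1 = e2.

Fixpoint walk (G : multigraph) (v : G) (p : seq (edge G)) (w : G) : bool :=
  if p is e :: p' then (source e == v) && walk (target e) p' w else v == w.

(* Uniqueness for [v := root] excludes edges into the root, and for the other
   vertices it forces in-degree one, so the underlying graph is a tree. *)
Definition rooted_tree (T : multigraph) (root : T) : Prop :=
  forall v : T, exists! p : seq (edge T), walk root p v.

Definition quota_tree (G : multigraph) (star : G) (q : G -> nat)
    (T : multigraph) (root : T) (f : graph_map T G) : Prop :=
  [/\ rooted_tree root, immersion f, f root = star
    & forall v : G, #|[set t | f t == v]| = q v].

Definition arrows_from (G T : multigraph) (f : graph_map T G) (t : T) :
  {set T * edge G} := [set x | (x.1 == t) && (source x.2 == f t)].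

(* The states of a quota search that grows the tree [T]: [A] is the set of tree
   vertices created so far, and [B] is the bag; a pair [(t, e)] in the bag is the
   edge [e] of [G] waiting to be followed from the tree vertex [t].  Edges are
   extracted from the bag in any order.  An extracted edge creates a new tree
   vertex over its target, whose outgoing edges join the bag, if the quota of
   that target is not yet met, and is discarded otherwise. *)
Inductive quota_search (G : multigraph) (q : G -> nat) (T : multigraph)
    (root : T) (f : graph_map T G) : {set T} -> {set T * edge G} -> Prop :=
| search_start : quota_search q root f [set root] (arrows_from f root)
| search_accept A B (e : edge T) :
    quota_search q root f A B ->
    (source e, emap f e) \in B ->
    #|[set t in A | f t == target (emap f e)]| < q (target (emap f e)) ->
    target e \notin A ->
    quota_search q root f (target e |: A)
      (B :\ (source e, emap f e) :|: arrows_from f (target e))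
| search_reject A B (t : T) (e : edge G) :
    quota_search q root f A B ->
    (t, e) \in B ->
    q (target e) <= #|[set u in A | f u == target e]| ->
    quota_search q root f A (B :\ (t, e)).

Definition produced_by_quota_search (G : multigraph) (q : G -> nat)
    (T : multigraph) (root : T) (f : graph_map T G) : Prop :=
  quota_search q root f setT set0.

Definition edge_label (Sigma : finType) (D0 : dfa Sigma) (T : multigraph)
    (f : graph_map T (dfa_graph D0)) (e : edge T) : Sigma :=
  (emap f e).2.

Definition admissible_transitions (Sigma : finType) (D0 : dfa Sigma)
    (T : multigraph) (f : graph_map T (dfa_graph D0))
    (d : T -> Sigma -> T) : Prop :=
  (forall e : edge T, d (source e) (edge_label f e) = target e) /\
  (forall v sigma,
     ~ (exists e : edge T, source e = v /\ edge_label f e = sigma) ->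
     f (d v sigma) = delta (f v : D0) sigma).

Definition expansion (Sigma : finType) (D0 : dfa Sigma) (T : multigraph)
    (root : T) (f : graph_map T (dfa_graph D0)) (d : T -> Sigma -> T) :
  dfa Sigma :=
  @Dfa Sigma T d root [set v | (f v : D0) \in dfa_acc D0].

Definition constructed_by_expansion (Sigma : finType) (D0 : dfa Sigma)
    (q : D0 -> nat) (D : dfa Sigma) : Prop :=
  (forall v, 0 < q v) /\
  exists (T : multigraph) (root : T) (f : graph_map T (dfa_graph D0))
         (d : T -> Sigma -> T),
    [/\ @quota_tree (dfa_graph D0) (dfa_init D0) q T root f,
        @produced_by_quota_search (dfa_graph D0) q T root f,
        admissible_transitions f d
      & dfa_isomorphic (expansion root f d) D].

(* Main.v *)
Require Import Defs.
From HB Require Import structures.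
From mathcomp Require Import all_boot.

Set Implicit Arguments.
Unset Strict Implicit.
Unset Printing Implicit Defensive.

(** The quotient map.  In a minimal DFA two states with the same future are
    equal and every state lies in each set that contains the initial state and
    is closed under transitions: otherwise a state could be saved.  Both facts
    are cases of one construction, the retract of a DFA
    ([minimal_no_proper_retract]).  Hence the state of [D0] reached by a word
    depends only on the state of [D] reached by that word, which defines the
    quotient map.

    The expansion.  Take a spanning tree of shortest paths in [D], rooted at its
    initial state ([exists_spanning_parent], [parent_graph_rooted_tree]).  The
    quotient map sends it to the graph of [D0].  This is an immersion because
    transitions of [D] are deterministic, and the number of tree vertices over
    [v] is the class size of [v], so it is a quota tree.  Every quota tree is
    the outcome of some quota search ([quota_tree_produced]): extract the tree
    edges first, each one as soon as its source has been created, and only then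
    the other edges, all of which are rejected because by then every quota is
    exhausted.  The transitions of [D] off the tree are legitimate choices for
    the remaining transitions of the expansion, which is therefore [D] itself.

    The enough arrows condition holds for every quota tree
    ([quota_tree_enough_arrows]): apart from the root, each tree vertex is the
    target of a tree edge, and by the immersion property the tree edges that end
    over [w] inject into the pairs of a tree vertex [t] and an edge of the graph
    from the image of [t] to [w]. *)

(** * Minimal automata *)

Section Automata.

Variable Sigma : finType.
Implicit Types D : dfa Sigma.

Definition same_future D (s t : D) : Prop :=
  forall w, (run s w \in dfa_acc D) = (run t w \in dfa_acc D).

Lemma run_rcons D (s : D) w a : run s (rcons w a) = delta (run s w) a.
Proof. exact: foldl_rcons. Qed.

Lemma run_cat D (s : D) w w' : run s (w ++ w') = run (run s w) w'.
Proof. exact: foldl_cat. Qed.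

(** Redirecting every arrow along [r] changes no future, so the states in [A],
    which the redirected arrows never leave, already recognize the language. *)
Lemma minimal_no_proper_retract D (L : seq Sigma -> Prop)
    (A : {set D}) (r : D -> D) :
  minimal_dfa D L ->
  (forall s, same_future (r s) s) ->
  r (dfa_init D) \in A ->
  (forall s a, s \in A -> r (delta s a) \in A) ->
  A = setT.
Proof.
move=> [recD minD] rP iA dA.
pose U := {s : D | s \in A}.
pose D' := @Dfa Sigma U
  (fun s a => exist _ (r (delta (val s) a)) (dA (val s) a (valP s)))
  (exist _ (r (dfa_init D)) iA) [set s : U | val s \in dfa_acc D].
have runP w : same_future (val (run (dfa_init D') w)) (run (dfa_init D) w).
  elim/last_ind: w => [|w a IHw] u; first exact: rP.
  rewrite !run_rcons rP.
  exact: IHw (a :: u).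
have recD' : recognizes D' L.
  move=> w; rewrite inE (runP w [::]); exact: recD.
apply/eqP; rewrite eqEcard subsetT cardsT.
by have := minD _ recD'; rewrite card_sig.
Qed.

(** Otherwise all arrows into [v] could be redirected to [u], which makes [v]
    superfluous. *)
Lemma minimal_same_future_eq D L (u v : D) :
  minimal_dfa D L -> same_future u v -> u = v.
Proof.
move=> minD uv; apply/eqP/negPn/negP => neq_uv.
pose r (s : D) := if s == v then u else s.
have rA s : r s \in [set~ v].
  by rewrite !inE /r; case: ifP => [_ //|/negbT].
have rP s : same_future (r s) s by rewrite /r; case: eqP => [->|].
have /setP/(_ v) := minimal_no_proper_retract minD rP (rA _) (fun s a _ => rA _).
by rewrite !inE eqxx.
Qed.

Lemma minimal_invariant_setT D L (A : {set D}) :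
  minimal_dfa D L -> dfa_init D \in A ->
  (forall s a, s \in A -> delta s a \in A) -> A = setT.
Proof. by move=> minD; apply: (@minimal_no_proper_retract _ _ _ id minD). Qed.

(** A state [s] goes to the state of [D0] reached by a chosen word leading to
    [s].  Any two such words have the same continuations in the language, so by
    minimality the choice does not matter; the image of the map contains the
    initial state and is closed under transitions, so the map is onto. *)
Lemma minimal_quotient_exists L (D0 D : dfa Sigma) :
  minimal_dfa D0 L -> connected_dfa D -> recognizes D L ->
  exists phi : D -> D0, quotient_map phi.
Proof.
move=> minD0 connD recD; have [recD0 _] := minD0.
have accE w : (run (dfa_init D0) w \in dfa_acc D0)
              = (run (dfa_init D) w \in dfa_acc D).
  by apply/idP/idP => [/recD0/recD|/recD/recD0].
have run_eq w w' : run (dfa_init D) w = run (dfa_init D) w' ->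
    run (dfa_init D0) w = run (dfa_init D0) w'.
  move=> eq_ww'; apply: (minimal_same_future_eq minD0) => u.
  by rewrite -!run_cat !accE !run_cat eq_ww'.
have exw (s : D) : exists w, run (dfa_init D) w == s.
  by have [w ->] := connD s; exists w.
pose word s := xchoose (exw s).
have wordP s : run (dfa_init D) (word s) = s by apply/eqP/(xchooseP (exw s)).
pose phi (s : D) := run (dfa_init D0) (word s).
have phi_init : phi (dfa_init D) = dfa_init D0.
  by apply: (run_eq _ [::]); rewrite wordP.
have phi_delta s a : delta (phi s) a = phi (delta s a).
  by rewrite -run_rcons; apply: run_eq; rewrite run_rcons !wordP.
exists phi; split=> // [v|s]; last by rewrite accE wordP.
have /setP/(_ v) : [set phi s | s in D] = setT.
  apply: (minimal_invariant_setT minD0) => [|_ a /imsetP[s _ ->]].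
    by rewrite -phi_init imset_f.
  by rewrite phi_delta imset_f.
by rewrite inE => /imsetP[s _ ->]; exists s.
Qed.

End Automata.

(** * Rooted trees and quota trees *)

Lemma walk_rcons (G : multigraph) (v : G) p e w :
  walk v (rcons p e) w = walk v p (source e) && (target e == w).
Proof.
by elim: p v => [|e' p IHp] v /=; rewrite 1?eq_sym // IHp andbA.
Qed.

(** The graph with one edge into each non-root vertex from its parent.  An edge
    is represented by its target. *)
Definition parent_graph (V : finType) (root : V) (par : {v | v != root} -> V) :=
  @Multigraph V {v | v != root} par val.

(** The rank forbids infinite ascents and is what makes every vertex reachable
    from the root.  Walks are unique because the endpoint of a walk determines
    its last edge. *)
Lemma parent_graph_rooted_tree (V : finType) (root : V)
    (par : {v | v != root} -> V) (rank : V -> nat) :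
  (forall e, rank (par e) < rank (val e)) ->
  @rooted_tree (parent_graph par) root.
Proof.
move=> rank_par v.
have [p pv] : exists p : seq (edge (parent_graph par)),
    walk (root : parent_graph par) p v.
  have [n] := ubnP (rank v); elim: n v => // n IHn v lt_n.
  have [->|v_root] := eqVneq v root; first by exists [::] => /=.
  pose e : edge (parent_graph par) := exist _ v v_root.
  have [|p pe] := IHn (source e); first exact: leq_trans (rank_par e) lt_n.
  by exists (rcons p e); rewrite walk_rcons pe /=.
exists p; split=> // p'.
elim/last_ind: p v p' pv => [|p e IHp] v p'.
  move=> /eqP <-; case/lastP: p' => // p' e.
  by rewrite walk_rcons /= => /andP[_]; rewrite (negPf (valP e)).
rewrite walk_rcons => /andP[pe /eqP <-]; case/lastP: p' => [|p' e'].
  by rewrite /= eq_sym (negPf (valP e)).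
rewrite walk_rcons => /andP[pe' /eqP/val_inj ee'].
by rewrite ee' in pe' *; rewrite (IHp _ _ pe pe').
Qed.

Lemma rooted_tree_target (T : multigraph) (root t : T) :
  rooted_tree root -> t != root -> exists e : edge T, target e = t.
Proof.
move=> treeT t_root; have [p [pt _]] := treeT t.
case/lastP: p pt => [/= rt|p e]; first by rewrite eq_sym rt in t_root.
by rewrite walk_rcons => /andP[_ /eqP <-]; exists e.
Qed.

Lemma walk_crossing (T : multigraph) (A : {set T}) (r v : T) p :
  walk r p v -> r \in A -> v \notin A ->
  exists2 e : edge T, source e \in A & target e \notin A.
Proof.
elim: p r => [|e p IHp] r /=; first by move=> /eqP -> ->.
move=> /andP[/eqP <- pe] eA vA.
have [teA|teA] := boolP (target e \in A); last by exists e.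
exact: IHp pe teA vA.
Qed.

Section QuotaTrees.

Variables (G : multigraph) (star : G) (q : G -> nat).
Variables (T : multigraph) (root : T) (f : graph_map T G).
Hypothesis qtree : quota_tree star q root f.

(** The phase of accepted edges.  The bag keeps every tree edge that leaves the
    current vertex set, because an accepted edge differs from it either in its
    source or, by the immersion property, in its image. *)
Lemma quota_tree_search_setT : exists B, quota_search q root f setT B.
Proof.
have [treeT immf _ cardf] := qtree.
pose grown n := exists (A : {set T}) (B : {set T * edge G}),
  [/\ #|A| = n, root \in A,
      forall e : edge T, source e \in A -> target e \notin A ->
        (source e, emap f e) \in B
    & quota_search q root f A B].
have T_gt0 : 0 < #|T| by apply/card_gt0P; exists root.
suff grow n : n < #|T| -> grown n.+1.
  have := grow #|T|.-1; rewrite prednK // => /(_ (leqnn _))[A [B [AT _ _ sAB]]].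
  exists B; suff <- : A = setT by [].
  by apply/eqP; rewrite eqEcard subsetT cardsT AT /=.
elim: n => [_|n IHn lt_nT].
  exists [set root], (arrows_from f root); split; rewrite ?cards1 ?set11 //.
    by move=> e /set1P es _; rewrite inE /= es eqxx -es source_emap /=.
  exact: search_start.
have [A [B [cardA rA bagP sAB]]] := IHn (ltnW lt_nT).
have /subsetPn[v _ vA] : ~~ ([set: T] \subset A).
  by apply/negP => /subset_leq_card; rewrite cardsT cardA leqNgt lt_nT.
have [p [pv _]] := treeT v.
have [e sA tA] := walk_crossing pv rA vA.
exists (target e |: A),
  (B :\ (source e, emap f e) :|: arrows_from f (target e)); split.
- by rewrite cardsU1 tA cardA.
- by rewrite inE rA orbT.
- move=> e'; rewrite !inE negb_or => /orP[/eqP es|es] /andP[ne te].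
    by rewrite es -es source_emap !eqxx orbT.
  rewrite bagP // andbT; apply/orP; left.
  apply: contra ne => /andP[/eqP ss /eqP ee].
  by rewrite (immf _ _ ss ee).
- apply: search_accept => //; first exact: bagP.
  (* [target e] lies over its own image and is not yet created: quota unmet. *)
  rewrite -cardf; apply/proper_card/properP; split.
    by apply/subsetP => t; rewrite !inE => /andP[].
  by exists (target e); rewrite !inE ?target_emap ?eqxx // (negPf tA).
Qed.

(** The phase of rejected edges: once all vertices are created, whatever is left
    in the bag meets an exhausted quota. *)
Lemma quota_tree_produced : produced_by_quota_search q root f.
Proof.
have [_ _ _ cardf] := qtree.
have [B sB] := quota_tree_search_setT.
have [n] := ubnP #|B|; elim: n B sB => // n IHn B sB ltBn.
have [B0|[[t e] teB]] := set_0Vmem B.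
  by rewrite /produced_by_quota_search -B0.
apply: (IHn (B :\ (t, e))).
  apply: search_reject => //.
  rewrite -cardf; apply: subset_leq_card.
  by apply/subsetP => u; rewrite !inE.
by rewrite (cardsD1 (t, e)) teB in ltBn.
Qed.

(** [into] loses no non-root vertex over [w], as each is the target of an edge;
    counting [pairs] by the image [v] of the tree vertex gives the sum. *)
Lemma quota_tree_enough_arrows :
  enough_arrows (fun w => if w == star then 1 else 0) q.
Proof.
have [treeT immf froot cardf] := qtree.
move=> w.
pose over := [set t | f t == w].
pose into := [set e : edge T | f (target e) == w].
pose pairs := [set x : T * edge G | (source x.2 == f x.1) && (target x.2 == w)].
have le_over : #|over| <= (if w == star then 1 else 0) + #|into|.
  rewrite (cardsD1 root) inE froot leq_add //; first by rewrite eq_sym; case: (w == star).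
  apply: leq_trans (leq_imset_card (@target T) into).
  apply/subset_leq_card/subsetP => t; rewrite !inE => /andP[t_root tw].
  have [e et] := rooted_tree_target treeT t_root.
  by rewrite -et imset_f // inE et.
have le_into : #|into| <= #|pairs|.
  have inj : injective (fun e : edge T => (source e, emap f e)).
    by move=> e1 e2 []; apply: immf.
  rewrite -(card_imset _ inj); apply/subset_leq_card/subsetP => _ /imsetP[e ew ->].
  by move: ew; rewrite !inE /= source_emap target_emap eqxx.
have pairsE : #|pairs| = \sum_(v : G) q v * multiplicity v w.
  transitivity (\sum_(t : T) multiplicity (f t) w).
    rewrite -sum1_card (eq_bigl _ _ (in_set _)).
    rewrite -(pair_big_dep xpredT
      (fun t g => (source g == f t) && (target g == w)) (fun _ _ => 1)) /=.
    apply: eq_bigr => t _; rewrite sum1_card /multiplicity cardsE.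
    exact: eq_card.
  rewrite (partition_big (vmap f) xpredT) //=; apply: eq_bigr => v _.
  rewrite -cardf -sum_nat_const.
  by apply: eq_big => [t|t /eqP ->]; rewrite ?inE.
by rewrite -cardf -pairsE (leq_trans le_over) // leq_add2l.
Qed.

End QuotaTrees.

(** * The spanning tree of a connected automaton *)

Section Spanning.

Variables (Sigma : finType) (D : dfa Sigma).
Hypothesis connD : connected_dfa D.

(** The rank is the length of a shortest word that leads to a state; the parent
    is the state before the last letter of such a word. *)
Lemma exists_spanning_parent :
  exists (rank : D -> nat) (par : {s : D | s != dfa_init D} -> D * Sigma),
    forall e, rank (par e).1 < rank (val e) /\
              delta (par e).1 (par e).2 = val e.
Proof.
pose reach (s : D) n := [exists w : n.-tuple Sigma, run (dfa_init D) w == s].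
have exn s : exists n, reach s n.
  have [w ->] := connD s; exists (size w); apply/existsP.
  by exists (in_tuple w).
pose rank s := ex_minn (exn s).
have rank_le w : rank (run (dfa_init D) w) <= size w.
  rewrite /rank; case: ex_minnP => m _; apply.
  by apply/existsP; exists (in_tuple w).
have expar (e : {s : D | s != dfa_init D}) : exists x : D * Sigma,
    (rank x.1 < rank (val e)) && (delta x.1 x.2 == val e).
  have : reach (val e) (rank (val e)) by rewrite /rank; case: ex_minnP.
  case/existsP => w; rewrite -{2}(size_tuple w).
  case/lastP: (tval w) => [|u a].
    by rewrite /run /= eq_sym (negPf (valP e)).
  rewrite run_rcons size_rcons => ua.
  by exists (run (dfa_init D) u, a); rewrite /= ltnS rank_le.
exists rank, (fun e => xchoose (expar e)) => e.
by case/andP: (xchooseP (expar e)) => ? /eqP.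
Qed.

End Spanning.

(** The tree has the states of [D] as vertices and [phi] as vertex map, so that
    the expansion whose transitions are those of [D] is isomorphic to [D] by the
    identity. *)
Lemma quotient_constructed_by_expansion (Sigma : finType) (D0 D : dfa Sigma)
    (phi : D -> D0) :
  connected_dfa D -> quotient_map phi ->
  constructed_by_expansion (class_size phi) D /\
  @enough_arrows (dfa_graph D0)
    (fun w => if w == dfa_init D0 then 1 else 0) (class_size phi).
Proof.
move=> connD [phi_onto phi_init phi_acc phi_delta].
have [rank [par parP]] := exists_spanning_parent connD.
pose T := parent_graph (fun e => (par e).1).
pose lift (e : edge T) : edge (dfa_graph D0) := (phi (par e).1, (par e).2).
have lift_source e : source (lift e) = phi (source e) by [].
have lift_target e : target (lift e) = phi (target e).
  by rewrite /= phi_delta (parP e).2.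
pose f : graph_map T (dfa_graph D0) := GraphMap lift_source lift_target.
have qtree : @quota_tree (dfa_graph D0) (dfa_init D0) (class_size phi)
               T (dfa_init D) f.
  split=> //.
    exact: (@parent_graph_rooted_tree _ _ _ rank (fun e => (parP e).1)).
  move=> e1 e2 /= s12 [_ a12]; apply: val_inj.
  by rewrite -(parP e1).2 -(parP e2).2 s12 a12.
split; last exact: quota_tree_enough_arrows qtree.
split=> [v|].
  by have [s sv] := phi_onto v; apply/card_gt0P; exists s; rewrite inE sv.
exists T, (dfa_init D), f, (@delta _ D); split=> //.
- exact: quota_tree_produced qtree.
- split=> [e|v a _]; first exact: (parP e).2.
  by rewrite /= phi_delta.
- exists id; first by exists id.
  by split=> // [v|s]; [exists v | rewrite inE phi_acc].
Qed.

Theorem theorem4 (Sigma : finType) (L : seq Sigma -> Prop)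
    (D0 D : dfa Sigma)
    (minD0 : minimal_dfa D0 L)
    (connD : connected_dfa D) (recD : recognizes D L) :
  (exists phi : D -> D0, quotient_map phi) /\
  forall phi : D -> D0, quotient_map phi ->
    constructed_by_expansion (class_size phi) D /\
    @enough_arrows (dfa_graph D0)
      (fun w => if w == dfa_init D0 then 1 else 0) (class_size phi).
Proof.
split=> [|phi]; first exact: minimal_quotient_exists minD0 connD recD.
exact: quotient_constructed_by_expansion connD.
Qed.
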